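(* Let $X$ be a Hausdorff topological group with operations and let $G$ be a regular $G$-method for $X$ which preserves the $G$-convergence of subsequences. If $X$ is $G$-locally compact, then $X\times X$ is $G$-locally compact.
   Context: Groups with operations. A category of groups with operations consists of groups (written additively, not necessarily abelian) with a set of operations $\Omega=\Omega_0\cup\Omega_1\cup\Omega_2$ ($\Omega_i$ the $i$-ary operations) and a set of identities including the group laws, such that: $\Omega_0=\{0\}$; $-\in\Omega_1$, $+\in\Omega_2$; with $\Omega_1'=\Omega_1\setminus\{-\}$ and $\Omega_2'=\Omega_2\setminus\{+\}$, if $\star\in\Omega_2'$ then $\star^\circ$, defined by $x\star^\circ y=y\star x$, is in $\Omega_2'$; and for $\star\in\Omega_2'$, $\omega\in\Omega_1'$ the identities $x\star(y+z)=x\star y+x\star z$, $\omega(x+y)=\omega(x)+\omega(y)$, $\omega(x)\star y=\omega(x\star y)$ hold. A morphism of groups with operations is a group homomorphism preserving the operations of $\Omega_1'$ and $\Omega_2'$. A subgroup with operations is a subgroup closed under all operations in $\Omega_1$ and $\Omega_2$. A topological group with operations is such an object with a topology making all operations continuous. $G$-methods. Let $s(X)$ be the set of all sequences in $X$, a group with operations under termwise operations. A $G$-method for $X$ is a morphism of groups with operations $G\colon c_G(X)\to X$ defined on a subgroup with operations $c_G(X)$ of $s(X)$. A sequence $\mathbf{x}$ is $G$-convergent to $\ell$ if $\mathbf{x}\in c_G(X)$ and $G(\mathbf{x})=\ell$; writing $G(\mathbf{x})=\ell$ includes $\mathbf{x}\in c_G(X)$. $G$ is regular if every convergent sequence $\mathbf{x}$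 in $X$ lies in $c_G(X)$ and $G(\mathbf{x})=\lim\mathbf{x}$. $G$ preserves the $G$-convergence of subsequences if, whenever $G(\mathbf{x})=\ell$, every subsequence of $\mathbf{x}$ is also $G$-convergent to $\ell$. Product. $X\times X$ carries the product topology and componentwise operations, and $G$ is applied to sequences in $X\times X$ componentwise: $(\mathbf{x},\mathbf{y})=((x_n,y_n))$ is $G$-convergent iff $\mathbf{x}$ and $\mathbf{y}$ are, and then $G(\mathbf{x},\mathbf{y})=(G(\mathbf{x}),G(\mathbf{y}))$. $G$-notions. Let $Y=X$ or $Y=X\times X$. A subset $A\subseteq Y$ is $G$-closed if whenever $\mathbf{x}$ is a sequence of points of $A$ with $G(\mathbf{x})=\ell$, then $\ell\in A$; it is $G$-open if $Y\setminus A$ is $G$-closed. $A$ is $G$-compact if every sequence of points in $A$ has a subsequence $\mathbf{y}$ with $G(\mathbf{y})=\ell\in A$. A $G$-neighbourhood of $a\in Y$ is a subset $V\subseteq Y$ for which there is a $G$-open $U$ with $a\in U\subseteq V$. $Y$ is $G$-locally compact if every point has a fundamental system of $G$-compact neighbourhoods: for every $a\in Y$ and every $G$-open $U$ containing $a$, there is a $G$-compact $G$-neighbourhood $K$ of $a$ with $K\subseteq U$. *)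

(* Defs.v *)
From HB Require Import structures.
From mathcomp Require Import all_boot all_order all_algebra.
From mathcomp Require Import all_classical all_reals all_analysis.

Set Implicit Arguments.
Unset Strict Implicit.
Unset Printing Implicit Defensive.

Local Open Scope classical_set_scope.
Local Open Scope group_scope.

(* The groups below need not be abelian, so they are [groupType]s and carry the
   multiplicative notation of the library: the "x + y", "- x" and "0" of the
   theory of groups with operations are [x * y], [x^-1] and [1] here. *)

(* [O1] and [O2] are the symbols of Omega_1' and Omega_2', that is, of the
   operations other than the group ones. *)
Inductive gwo_term (O1 O2 : Type) : Type :=
| GVar of nat
| GZero
| GOpp of gwo_term O1 O2
| GAdd of gwo_term O1 O2 & gwo_term O1 O2
| GOp1 of O1 & gwo_term O1 O2
| GOp2 of O2 & gwo_term O1 O2 & gwo_term O1 O2.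

Fixpoint gwo_eval (O1 O2 : Type) (Y : groupType)
    (f1 : O1 -> Y -> Y) (f2 : O2 -> Y -> Y -> Y)
    (e : nat -> Y) (t : gwo_term O1 O2) : Y :=
  match t with
  | GVar n => e n
  | GZero => 1
  | GOpp s => (gwo_eval f1 f2 e s)^-1
  | GAdd s r => gwo_eval f1 f2 e s * gwo_eval f1 f2 e r
  | GOp1 w s => f1 w (gwo_eval f1 f2 e s)
  | GOp2 b s r => f2 b (gwo_eval f1 f2 e s) (gwo_eval f1 f2 e r)
  end.

(* A category of groups with operations.  [gwo_flip] sends a binary operation
   to its opposite.  [gwo_identities] holds the identities imposed in addition
   to the compulsory ones, which are the group laws and the laws of [isGwo]. *)
Record gwo_category : Type := GwoCategory {
  gwo_O1 : Type;
  gwo_O2 : Type;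
  gwo_flip : gwo_O2 -> gwo_O2;
  gwo_identities : set (gwo_term gwo_O1 gwo_O2 * gwo_term gwo_O1 gwo_O2)
}.

HB.mixin Record isGwo (C : gwo_category) Y of Group Y := {
  op1 : gwo_O1 C -> Y -> Y;
  op2 : gwo_O2 C -> Y -> Y -> Y;
  op2_flip : forall s (x y : Y), op2 (gwo_flip s) x y = op2 s y x;
  op2Mr : forall s (x y z : Y), op2 s x (y * z) = op2 s x y * op2 s x z;
  op1M : forall w (x y : Y), op1 w (x * y) = op1 w x * op1 w y;
  op2_op1l : forall w s (x y : Y), op2 s (op1 w x) y = op1 w (op2 s x y);
  gwo_identityP : forall t, gwo_identities t ->
    forall e : nat -> Y, gwo_eval op1 op2 e t.1 = gwo_eval op1 op2 e t.2
}.

#[short(type="gwoType")]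
HB.structure Definition Gwo (C : gwo_category) := {Y of isGwo C Y & Group Y}.

HB.mixin Record isTopologicalGwo (C : gwo_category) X
    of Gwo C X & Topological X := {
  mulg_continuous : continuous (fun p : X * X => p.1 * p.2);
  invg_continuous : continuous (fun x : X => x^-1);
  op1_continuous : forall w : gwo_O1 C, continuous (fun x : X => op1 w x);
  op2_continuous : forall s : gwo_O2 C,
    continuous (fun p : X * X => op2 s p.1 p.2)
}.

#[short(type="topologicalGwoType")]
HB.structure Definition TopologicalGwo (C : gwo_category) :=
  {X of isTopologicalGwo C X & Gwo C X & Topological X}.

Section SequenceGroup.
Variable Y : groupType.
Implicit Types u v w : nat -> Y.

Definition seq_mul u v : nat -> Y := fun n => u n * v n.
Definition seq_one : nat -> Y := fun=> 1.
Definition seq_inv u : nat -> Y := fun n => (u n)^-1.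

Fact seq_mulA : associative seq_mul.
Proof. by move=> u v w; apply/funext => n; exact: mulgA. Qed.
Fact seq_mul1 : left_id seq_one seq_mul.
Proof. by move=> u; apply/funext => n; exact: mul1g. Qed.
Fact seq_mulr1 : right_id seq_one seq_mul.
Proof. by move=> u; apply/funext => n; exact: mulg1. Qed.
Fact seq_mulV : left_inverse seq_one seq_inv seq_mul.
Proof. by move=> u; apply/funext => n; exact: mulVg. Qed.
Fact seq_mulrV : right_inverse seq_one seq_inv seq_mul.
Proof. by move=> u; apply/funext => n; exact: mulgV. Qed.

HB.instance Definition _ := isGroup.Build (nat -> Y)
  seq_mulA seq_mul1 seq_mulr1 seq_mulV seq_mulrV.
End SequenceGroup.

Section SequenceGwo.
Variables (C : gwo_category) (Y : gwoType C).
Implicit Types u v w : nat -> Y.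

Definition seq_op1 (o : gwo_O1 C) u : nat -> Y := fun n => op1 o (u n).
Definition seq_op2 (s : gwo_O2 C) u v : nat -> Y := fun n => op2 s (u n) (v n).

Fact seq_op2_flip s u v : seq_op2 (gwo_flip s) u v = seq_op2 s v u.
Proof. by apply/funext => n; exact: op2_flip. Qed.
Fact seq_op2Mr s u v w : seq_op2 s u (v * w) = seq_op2 s u v * seq_op2 s u w.
Proof. by apply/funext => n; exact: op2Mr. Qed.
Fact seq_op1M o u v : seq_op1 o (u * v) = seq_op1 o u * seq_op1 o v.
Proof. by apply/funext => n; exact: op1M. Qed.
Fact seq_op2_op1l o s u v :
  seq_op2 s (seq_op1 o u) v = seq_op1 o (seq_op2 s u v).
Proof. by apply/funext => n; exact: op2_op1l. Qed.
Fact seq_eval (e : nat -> nat -> Y) t n :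
  gwo_eval seq_op1 seq_op2 e t n =
  gwo_eval (@op1 C Y) (@op2 C Y) (fun i => e i n) t.
Proof.
elim: t => //= [s <-//|s <- r <-//|o s <-//|b s <- r <-//].
Qed.
Fact seq_identityP t : gwo_identities t -> forall e : nat -> nat -> Y,
  gwo_eval seq_op1 seq_op2 e t.1 = gwo_eval seq_op1 seq_op2 e t.2.
Proof.
by move=> Ct e; apply/funext => n; rewrite !seq_eval; exact: gwo_identityP.
Qed.

HB.instance Definition _ := isGwo.Build C (nat -> Y)
  seq_op2_flip seq_op2Mr seq_op1M seq_op2_op1l seq_identityP.
End SequenceGwo.

Section ProductGwo.
Variables (C : gwo_category) (Y Z : gwoType C).
Implicit Types p q r : Y * Z.

Definition pair_op1 (w : gwo_O1 C) p : Y * Z := (op1 w p.1, op1 w p.2).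
Definition pair_op2 (s : gwo_O2 C) p q : Y * Z :=
  (op2 s p.1 q.1, op2 s p.2 q.2).

Fact pair_op2_flip s p q : pair_op2 (gwo_flip s) p q = pair_op2 s q p.
Proof. by congr pair; exact: op2_flip. Qed.
Fact pair_op2Mr s p q r :
  pair_op2 s p (q * r) = pair_op2 s p q * pair_op2 s p r.
Proof. by congr pair; exact: op2Mr. Qed.
Fact pair_op1M w p q : pair_op1 w (p * q) = pair_op1 w p * pair_op1 w q.
Proof. by congr pair; exact: op1M. Qed.
Fact pair_op2_op1l w s p q :
  pair_op2 s (pair_op1 w p) q = pair_op1 w (pair_op2 s p q).
Proof. by congr pair; exact: op2_op1l. Qed.
Fact pair_eval (e : nat -> Y * Z) t :
  gwo_eval pair_op1 pair_op2 e t =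
  (gwo_eval (@op1 C Y) (@op2 C Y) (fst \o e) t,
   gwo_eval (@op1 C Z) (@op2 C Z) (snd \o e) t).
Proof.
elim: t => //= [n|s ->//|s -> r ->//|o s ->//|b s -> r ->//].
by rewrite -surjective_pairing.
Qed.
Fact pair_identityP t : gwo_identities t -> forall e : nat -> Y * Z,
  gwo_eval pair_op1 pair_op2 e t.1 = gwo_eval pair_op1 pair_op2 e t.2.
Proof.
by move=> Ct e; rewrite !pair_eval; congr pair; exact: gwo_identityP.
Qed.

HB.instance Definition _ := isGwo.Build C (Y * Z)%type
  pair_op2_flip pair_op2Mr pair_op1M pair_op2_op1l pair_identityP.
End ProductGwo.

Record is_gwo_subgroup (C : gwo_category) (Y : gwoType C) (A : set Y) : Prop :=
  IsGwoSubgroup {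
  gwo_subgroup1 : A 1;
  gwo_subgroupM : forall x y : Y, A x -> A y -> A (x * y);
  gwo_subgroupV : forall x : Y, A x -> A x^-1;
  gwo_subgroup_op1 : forall (w : gwo_O1 C) (x : Y), A x -> A (op1 w x);
  gwo_subgroup_op2 : forall (s : gwo_O2 C) (x y : Y),
    A x -> A y -> A (op2 s x y)
}.

(* The values of [f] outside [A] are irrelevant. *)
Record is_gwo_morphism_on (C : gwo_category) (Y Z : gwoType C)
    (A : set Y) (f : Y -> Z) : Prop := IsGwoMorphismOn {
  gwo_morphM : forall x y : Y, A x -> A y -> f (x * y) = f x * f y;
  gwo_morph_op1 : forall (w : gwo_O1 C) (x : Y),
    A x -> f (op1 w x) = op1 w (f x);
  gwo_morph_op2 : forall (s : gwo_O2 C) (x y : Y),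
    A x -> A y -> f (op2 s x y) = op2 s (f x) (f y)
}.

Record gmethod (C : gwo_category) (Y : gwoType C) : Type := GMethod {
  gdom : set (nat -> Y);
  glim :> (nat -> Y) -> Y;
  gdom_subgroup : is_gwo_subgroup gdom;
  glim_morphism : is_gwo_morphism_on gdom glim
}.

Section ProductMethod.
Variables (C : gwo_category) (Y : gwoType C) (G : gmethod Y).

Definition gdom_prod : set (nat -> Y * Y) :=
  [set u | gdom G (fst \o u) /\ gdom G (snd \o u)].
Definition glim_prod (u : nat -> Y * Y) : Y * Y := (G (fst \o u), G (snd \o u)).

Fact gdom_prod_subgroup : is_gwo_subgroup gdom_prod.
Proof.
have [H1 HM HV Ho Hs] := gdom_subgroup G; split.
- by split; exact: H1.
- by move=> u v [u1 u2] [v1 v2]; split;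
    [exact: HM u1 v1 | exact: HM u2 v2].
- by move=> u [u1 u2]; split; [exact: HV u1 | exact: HV u2].
- by move=> w u [u1 u2]; split; [exact: Ho u1 | exact: Ho u2].
- by move=> s u v [u1 u2] [v1 v2]; split;
    [exact: Hs u1 v1 | exact: Hs u2 v2].
Qed.

Fact glim_prod_morphism : is_gwo_morphism_on gdom_prod glim_prod.
Proof.
have [HM Ho Hs] := glim_morphism G; split.
- by move=> u v [u1 u2] [v1 v2]; congr pair;
    [exact: HM u1 v1 | exact: HM u2 v2].
- by move=> w u [u1 u2]; congr pair; [exact: Ho u1 | exact: Ho u2].
- by move=> s u v [u1 u2] [v1 v2]; congr pair;
    [exact: Hs u1 v1 | exact: Hs u2 v2].
Qed.

Definition gmethod_prod : gmethod (Y * Y)%type :=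
  GMethod gdom_prod_subgroup glim_prod_morphism.
End ProductMethod.

Section GNotions.
Variables (C : gwo_category) (Y : gwoType C) (G : gmethod Y).

Definition gconv (u : nat -> Y) (l : Y) : Prop := gdom G u /\ G u = l.

Definition preserves_gconv_subseq : Prop :=
  forall (u : nat -> Y) (l : Y), gconv u l ->
  forall phi : nat -> nat, {homo phi : m n / (m < n)%N} -> gconv (u \o phi) l.

Definition gclosed (A : set Y) : Prop :=
  forall (u : nat -> Y) (l : Y), (forall n, A (u n)) -> gconv u l -> A l.

Definition gopen (A : set Y) : Prop := gclosed (~` A).

Definition gcompact (A : set Y) : Prop :=
  forall u : nat -> Y, (forall n, A (u n)) ->
  exists phi : nat -> nat, {homo phi : m n / (m < n)%N} /\
  exists l : Y, gconv (u \o phi) l /\ A l.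

Definition gneighbourhood (a : Y) (V : set Y) : Prop :=
  exists U : set Y, [/\ gopen U, U a & U `<=` V].

Definition glocally_compact : Prop :=
  forall (a : Y) (U : set Y), gopen U -> U a ->
  exists K : set Y, [/\ gcompact K, gneighbourhood a K & K `<=` U].
End GNotions.

Definition gregular (C : gwo_category) (X : topologicalGwoType C)
    (G : gmethod X) : Prop :=
  forall (u : nat -> X) (l : X), u @ \oo --> l -> gconv G u l.

(* Main.v *)
Require Import Defs.
From mathcomp Require Import all_boot all_order all_algebra.
From mathcomp Require Import all_classical all_reals all_analysis.

(** The argument is the one by which the product of a locally sequentially
    compact sequential space with a sequential space is again sequential.  Let
    [W] be a G-open set of pairs around [(a, b)].  The slice of [W] at height
    [b] is G-open ([gopen_slice]), so it contains a G-compact neighbourhood [K]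
    of [a].  The set of the [y] for which the whole segment [K * {y}] stays in
    [W] contains [b], and it is G-open by a sequential tube lemma
    ([gopen_tube]), so it contains a G-compact neighbourhood [L] of [b].  The
    box [K * L] lies in [W]; it is G-compact, by extracting a subsequence twice
    ([gcompactX]), and it is a neighbourhood of [(a, b)], because boxes of
    G-open sets are G-open ([gopenX]).

    Preservation of G-convergence by subsequences enters each time that a
    subsequence is extracted; regularity supplies the G-convergence of constant
    sequences, which makes slices G-open. *)

Local Open Scope classical_set_scope.

Lemma frequently_subseq {P : set nat} :
  (forall N, exists2 n, (N <= n)%N & P n) ->
  exists2 phi : nat -> nat, {homo phi : m n / (m < n)%N} & forall n, P (phi n).
Proof.
move=> freqP.
have /choice[f fP] : forall N, exists n, (N <= n)%N /\ P n.
  by move=> N; have [n Nn Pn] := freqP N; exists n.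
exists (fix phi n := if n is m.+1 then f (phi m).+1 else f 0%N).
  by apply: homo_ltn; [exact: ltn_trans | move=> n; exact: (fP _).1].
by case=> [|n]; exact: (fP _).2.
Qed.

Section GTopology.
Context {C : gwo_category} {Y : gwoType C} {G : gmethod Y}.
Hypothesis subseqG : preserves_gconv_subseq G.

(** A sequence in [A `|` B] visits [A] infinitely often or is eventually in
    [B]; either way it has a subsequence in one of the two sets, with the same
    limit. *)
Lemma gclosedU {A B : set Y} :
  gclosed G A -> gclosed G B -> gclosed G (A `|` B).
Proof.
move=> Acl Bcl u l ABu ul.
have [freqA|] := pselect (forall N, exists2 n, (N <= n)%N & A (u n)).
  have [phi phi_incr Aphi] := frequently_subseq freqA.
  by left; apply: (Acl (u \o phi)) => //; exact: subseqG.
move=> /existsNP[N NA]; right; apply: (Bcl (u \o addn N)).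
  move=> n; have [|//] := ABu (N + n)%N => An.
  by case: NA; exists (N + n)%N => //; exact: leq_addr.
by apply: subseqG => // m n mn; rewrite ltn_add2l.
Qed.

Lemma gopenI {A B : set Y} : gopen G A -> gopen G B -> gopen G (A `&` B).
Proof. by rewrite /gopen setCI; exact: gclosedU. Qed.

End GTopology.

Section GProduct.
Context {C : gwo_category} {Y : gwoType C} {G : gmethod Y}.

Lemma gconv_pair {u v : nat -> Y} {k l : Y} :
  gconv G u k -> gconv G v l ->
  gconv (gmethod_prod G) (fun n => (u n, v n)) (k, l).
Proof. by move=> [du <-] [dv <-]. Qed.

Lemma gconv_fst {u : nat -> Y * Y} {l : Y * Y} :
  gconv (gmethod_prod G) u l -> gconv G (fst \o u) l.1.
Proof. by move=> [[du _] <-]. Qed.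

Lemma gconv_snd {u : nat -> Y * Y} {l : Y * Y} :
  gconv (gmethod_prod G) u l -> gconv G (snd \o u) l.2.
Proof. by move=> [[_ du] <-]. Qed.

Lemma gopen_fst {A : set Y} :
  gopen G A -> gopen (gmethod_prod G) (fst @^-1` A).
Proof. by move=> Aop u l uA /gconv_fst; exact: (Aop (fst \o u)). Qed.

Lemma gopen_snd {A : set Y} :
  gopen G A -> gopen (gmethod_prod G) (snd @^-1` A).
Proof. by move=> Aop u l uA /gconv_snd; exact: (Aop (snd \o u)). Qed.

(** Horizontal slices are preimages under [x |-> (x, b)], which preserves
    G-convergence as soon as constant sequences G-converge. *)
Lemma gopen_slice {W : set (Y * Y)} {b : Y} :
  gconv G (fun=> b) b ->
  gopen (gmethod_prod G) W -> gopen G [set x | W (x, b)].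
Proof.
move=> bb Wop u l uW ul.
exact: (Wop (fun n => (u n, b)) (l, b) uW (gconv_pair ul bb)).
Qed.

Hypothesis subseqG : preserves_gconv_subseq G.

Lemma preserves_gconv_subseq_prod : preserves_gconv_subseq (gmethod_prod G).
Proof.
move=> u l ul phi phi_incr; rewrite [l]surjective_pairing.
exact: gconv_pair (subseqG _ _ (gconv_fst ul) _ phi_incr)
  (subseqG _ _ (gconv_snd ul) _ phi_incr).
Qed.

Lemma gopenX {A B : set Y} :
  gopen G A -> gopen G B -> gopen (gmethod_prod G) (A `*` B).
Proof.
move=> Aop Bop; apply: (gopenI preserves_gconv_subseq_prod).
- exact: gopen_fst.
- exact: gopen_snd.
Qed.

Lemma gcompactX {K L : set Y} :
  gcompact G K -> gcompact G L -> gcompact (gmethod_prod G) (K `*` L).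
Proof.
move=> Kc Lc u uKL.
have [phi [phi_incr [k [uk Kk]]]] := Kc (fst \o u) (fun n => (uKL n).1).
have [psi [psi_incr [l [ul Ll]]]] :=
  Lc (snd \o u \o phi) (fun n => (uKL (phi n)).2).
exists (phi \o psi); split; first by move=> m n /psi_incr/phi_incr.
exists (k, l); split=> //.
exact: gconv_pair (subseqG _ _ uk _ psi_incr) ul.
Qed.

(** A sequential tube lemma: if segments [K * {y_n}] leave [W] at points
    [(x_n, y_n)] while [y_n] tends to [y], then a G-limit [x] in [K] of a
    subsequence of the [x_n] shows that [K * {y}] leaves [W] too, at
    [(x, y)]. *)
Lemma gopen_tube {K : set Y} {W : set (Y * Y)} :
  gcompact G K -> gopen (gmethod_prod G) W ->
  gopen G [set y | forall x, K x -> W (x, y)].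
Proof.
move=> Kc Wop v y vNW vy.
have /choice[u uP] : forall n, exists x, K x /\ ~ W (x, v n).
  by move=> n; have /existsNP[x /not_implyP] := vNW n; exists x.
have [phi [phi_incr [x [ux Kx]]]] := Kc u (fun n => (uP n).1).
move=> /(_ x Kx).
exact: (Wop _ _ (fun n => (uP (phi n)).2)
  (gconv_pair ux (subseqG _ _ vy _ phi_incr))).
Qed.

Lemma glocally_compact_prod :
  (forall a : Y, gconv G (fun=> a) a) ->
  glocally_compact G -> glocally_compact (gmethod_prod G).
Proof.
move=> cstG lcY [a b] W Wop Wab.
have [K [Kc [A [Aop Aa AK]] KW]] := lcY a _ (gopen_slice (cstG b) Wop) Wab.
have [L [Lc [B [Bop Bb BL]] LW]] := lcY b _ (gopen_tube Kc Wop) KW.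
exists (K `*` L); split.
- exact: gcompactX.
- exists (A `*` B); split => //; first exact: gopenX.
  by move=> [x y] [/= Ax By]; split; [exact: AK | exact: BL].
- by move=> [x y] [/= Kx Ly]; exact: LW.
Qed.

End GProduct.

Theorem theorem3p11 (C : gwo_category) (X : topologicalGwoType C)
    (G : gmethod X) (hausdorffX : hausdorff_space X)
    (regularG : gregular G) (subseqG : preserves_gconv_subseq G)
    (locally_compactX : glocally_compact G) :
  glocally_compact (gmethod_prod G).
Proof.
by apply: glocally_compact_prod => // a; apply: regularG; exact: cvg_cst.
Qed.
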